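(* For a dcpo $P$, the following two conditions are equivalent: (1) $\Sigma P$ is a $d^{*}$-space. (2) For every $A\in\Gamma(P)\setminus\{P\}$ and every $x\in P$, ${\downarrow}({\uparrow}x\cap A)\in\Gamma(P)$.
   Context: A dcpo is a poset in which every directed subset (nonempty, with every finite subset having an upper bound in it) has a supremum. $\Sigma P=(P,\sigma(P))$ is $P$ with the Scott topology: $U\in\sigma(P)$ iff $U$ is an upper set and for every directed $D\subseteq P$ whose supremum exists, $\sup D\in U$ implies $D\cap U\neq\varnothing$. $\Gamma(P)$ denotes the set of all Scott closed subsets of $P$. For $A\subseteq P$, ${\uparrow}A=\{x\in P\mid x\geq a\text{ for some }a\in A\}$, ${\downarrow}A=\{x\in P\mid x\leq a\text{ for some }a\in A\}$, and ${\uparrow}x={\uparrow}\{x\}$. A $T_0$ space $X$ is a $d^{*}$-space if for every directed subset $D$ of $X$, every $x\in X$ and every nonempty open set $U\subseteq X$, $\bigcap_{d\in D}{\uparrow}d\cap{\uparrow}x\subseteq U$ implies ${\uparrow}d\cap{\uparrow}x\subseteq U$ for some $d\in D$, where directedness and ${\uparrow}$ refer to the specialization order $x\leq y$ iff $x\in\overline{\{y\}}$ (for $\Sigma P$ this is the order of $P$). *)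

(* Defs.v *)
From HB Require Import structures.
From mathcomp Require Import all_boot all_order.
From mathcomp Require Import all_classical topology.

Set Implicit Arguments.
Unset Strict Implicit.
Unset Printing Implicit Defensive.

Import Order.TTheory.
Local Open Scope classical_set_scope.

(* Relative to an arbitrary relation, because the same notions are used both
   for the order of a poset and for the specialization order of a space. *)
Definition directed_for (T : Type) (r : T -> T -> Prop) (D : set T) : Prop :=
  D !=set0 /\
  forall F : set T, finite_set F -> F `<=` D ->
    exists2 u, D u & forall x, F x -> r x u.

Definition up_for (T : Type) (r : T -> T -> Prop) (A : set T) : set T :=
  [set x | exists2 a, A a & r a x].

Definition ple {d : Order.disp_t} (P : porderType d) (x y : P) : Prop :=
  (x <= y)%O.

Definition dcpo {d : Order.disp_t} (P : porderType d) : Prop :=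
  forall D : set P, directed_for (@ple d P) D -> exists s, isLub D s.

Definition scott_open {d : Order.disp_t} (P : porderType d) : set (set P) :=
  [set U | (forall x y : P, U x -> (x <= y)%O -> U y) /\
           (forall (D : set P) (s : P), directed_for (@ple d P) D ->
              isLub D s -> U s -> D `&` U !=set0)].
Arguments scott_open {d} P.

Lemma scott_openT {d : Order.disp_t} (P : porderType d) :
  scott_open P setT.
Proof. by split=> // D s [[x Dx] _] _ _; exists x. Qed.

Lemma scott_openI {d : Order.disp_t} (P : porderType d) :
  setI_closed (scott_open P).
Proof.
move=> U V [Uup Uscott] [Vup Vscott]; split=> [x y [Ux Vx] xy|D s dirD lubs].
  by split; [exact: Uup xy|exact: Vup xy].
case=> Us Vs.
have [a [Da Ua]] := Uscott D s dirD lubs Us.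
have [b [Db Vb]] := Vscott D s dirD lubs Vs.
have [|x|c Dc cub] := dirD.2 [set a; b]; first exact: finite_set2.
  by case=> ->.
exists c; split=> //; split.
- by apply: Uup Ua _; apply: cub; left.
- by apply: Vup Vb _; apply: cub; right.
Qed.

Lemma scott_open_bigU {d : Order.disp_t} (P : porderType d) (I : Type)
    (f : I -> set P) :
  (forall i, scott_open P (f i)) -> scott_open P (\bigcup_i f i).
Proof.
move=> fo; split=> [x y [i _ fix_] xy|D s dirD lubs [i _ fis]].
  by exists i => //; exact: (fo i).1 xy.
by have [x [Dx fix_]] := (fo i).2 D s dirD lubs fis; exists x; split=> //; exists i.
Qed.

(* The space Sigma P: an alias of P carrying the Scott topology. *)
Definition Scott {d : Order.disp_t} (P : porderType d) : Type := P.

HB.instance Definition _ (d : Order.disp_t) (P : porderType d) :=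
  Choice.copy (Scott P) P.

HB.instance Definition _ (d : Order.disp_t) (P : porderType d) :=
  isOpenTopological.Build (Scott P)
    (@scott_openT d P) (@scott_openI d P) (@scott_open_bigU d P).

Definition scott_closed {d : Order.disp_t} (P : porderType d) : set (set P) :=
  [set A | closed (A : set (Scott P))].
Arguments scott_closed {d} P.

Definition specialization (X : topologicalType) (x y : X) : Prop :=
  closure [set y] x.

Definition dstar_space (X : topologicalType) : Prop :=
  kolmogorov_space X /\
  forall D : set X, directed_for (@specialization X) D ->
  forall (x : X) (U : set X), open U -> U !=set0 ->
    (\bigcap_(d in D) up_for (@specialization X) [set d]) `&`
      up_for (@specialization X) [set x] `<=` U ->
    exists2 d, D d &
      up_for (@specialization X) [set d] `&`
      up_for (@specialization X) [set x] `<=` U.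

(* The specialization order of Sigma P is the order of P. *)
Lemma Scott_specialization {d : Order.disp_t} (P : porderType d)
    (x y : Scott P) :
  specialization x y <-> ple (x : P) y.
Proof.
split; last first.
  move=> xy B; rewrite nbhsE => -[V [oV Vx] VB].
  by exists y; split=> //; apply: VB; exact: oV.1 Vx xy.
move=> clx; apply: contrapT => nxy.
have oV : open ([set z : P | ~~ (z <= y)%O] : set (Scott P)).
  split=> [a b /= + ab|D m dD lm /= my].
    by apply: contraNN; exact: le_trans.
  apply: contrapT => DV0; move/negP: my; apply; apply: lm.2 => z Dz.
  by apply: contrapT => /negP zy; apply: DV0; exists z.
have /clx : nbhs x ([set z : P | ~~ (z <= y)%O] : set (Scott P)).
  by apply: open_nbhs_nbhs; split=> //; apply/negP.
by case=> z [-> /=]; rewrite lexx.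
Qed.

(* Main.v *)
(** In a dcpo, a directed set [D] with supremum [s] satisfies
    [\bigcap_(d in D) ↑d = ↑s].  With [A] the complement of [U], the inclusion
    [↑y ∩ ↑x ⊆ U] says exactly that [y] is not in [↓(↑x ∩ A)].  So the
    d*-condition for [D], [x], [U] reads: if [s] lies outside [↓(↑x ∩ A)], so does
    some member of [D]; this is Scott closedness of the lower set [↓(↑x ∩ A)]. *)
Require Import Defs.
From mathcomp Require Import all_boot all_order all_classical topology.

Import Order.TTheory.
Local Open Scope classical_set_scope.

(** Used to move directedness between the specialization order of [Scott P] and the order of [P]. *)
Lemma eq_directed_for {T : Type} {r r' : T -> T -> Prop} {D : set T} :
  (forall x y, r x y <-> r' x y) -> directed_for r D <-> directed_for r' D.
Proof.
move=> rr'; split=> -[D0 Dub]; split=> // F finF FD;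
  have [u Du Fu] := Dub F finF FD; exists u => // x Fx; exact/rr'/Fu.
Qed.

Section ScottTopology.
Context {d : Order.disp_t} {P : porderType d}.

Lemma up_for_ple1 (x y : P) : up_for (@ple d P) [set x] y <-> (x <= y)%O.
Proof. by split=> [[_ ->]|xy] //; exists x. Qed.

Lemma up_for_specialization1 (x y : Scott P) :
  up_for (@specialization (Scott P)) [set x] y <-> (x <= y :> P)%O.
Proof.
split=> [[_ -> /Scott_specialization]|xy] //.
by exists x => //; apply/Scott_specialization.
Qed.

Lemma isLub_le (D : set P) (s z : P) :
  isLub D s -> (forall y, D y -> (y <= z)%O) <-> (s <= z)%O.
Proof.
move=> [ubs leasts]; split=> [ubz|sz y Dy]; first exact: leasts.
by apply: le_trans sz; exact: ubs.
Qed.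

Lemma scott_closedE (A : set P) : scott_closed P A <-> scott_open P (~` A).
Proof. by rewrite /scott_closed /= -openC. Qed.

(** By antisymmetry, distinct points fail to be comparable in at least one direction. If [x <= y]
    fails, then [x] is outside the closure of [y], so some neighbourhood of [x] misses [y]. *)
Lemma Scott_kolmogorov : kolmogorov_space (Scott P).
Proof.
have sep (x y : Scott P) : ~ (x <= y :> P)%O ->
    exists2 V : set (Scott P), nbhs x V & ~ V y.
  move=> nxy; apply: contrapT => noV; apply: nxy.
  apply/Scott_specialization => V Vx; exists y; split=> //.
  by apply: contrapT => nVy; apply: noV; exists V.
move=> x y xy; have [lexy|/negP/sep[V Vx nVy]] := boolP (x <= y :> P)%O.
  have [|V Vy nVx] := sep y x.
    by move=> leyx; move/eqP: xy; apply; apply: (@le_anti _ P); rewrite lexy.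
  by exists V; right; rewrite !inE.
by exists V; left; rewrite !inE.
Qed.

Lemma up_subsetC_down (A : set P) (x y : P) :
  up_for (@specialization (Scott P)) [set (y : Scott P)] `&`
    up_for (@specialization (Scott P)) [set (x : Scott P)] `<=` ~` A <->
  ~ down (up_for (@ple d P) [set x] `&` A) y.
Proof.
split=> [yxA /downP[z [/up_for_ple1 xz Az] yz]|ny z [/up_for_specialization1 yz]].
  by apply: (yxA z) => //; split; apply/up_for_specialization1.
move=> /up_for_specialization1 xz Az; apply: ny; apply/downP.
by exists z => //; split=> //; apply/up_for_ple1.
Qed.

Lemma bigcap_up_isLub (D : set P) (s : P) : isLub D s ->
  \bigcap_(y in (D : set (Scott P))) up_for (@specialization (Scott P)) [set y] =
  up_for (@specialization (Scott P)) [set (s : Scott P)].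
Proof.
move=> lubs; apply/seteqP; split=> z.
  move=> Dz; apply/up_for_specialization1/(isLub_le _ _ _ lubs) => y Dy.
  exact/up_for_specialization1/Dz.
move=> /up_for_specialization1/(isLub_le _ _ _ lubs) sz y Dy.
exact/up_for_specialization1/sz.
Qed.

End ScottTopology.

Theorem theorem3p6 (d : Order.disp_t) (P : porderType d) (hP : dcpo P) :
  dstar_space (Scott P) <->
  (forall A : set P, (scott_closed P `\ setT) A ->
   forall x : P, scott_closed P (down (up_for (@ple d P) [set x] `&` A))).
Proof.
split=> [[_ dstar] A [clA AT] x|downcl].
  (* The complement of a lower set is an upper set; the d*-condition is kept for the clause on
     directed suprema. *)
  apply/scott_closedE; split=> [y z ny yz /downP[w Aw zw]|D s dirD lubs ns].
    by apply: ny; apply/downP; exists w => //; exact: le_trans yz zw.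
  have [||||y Dy yx] := dstar D _ x (~` A).
  - exact/(eq_directed_for (@Scott_specialization d P)).
  - exact/scott_closedE.
  - by apply/set0P/eqP => A0; apply: AT; rewrite -[A]setCK A0 setC0.
  - by rewrite (bigcap_up_isLub _ _ lubs); exact/up_subsetC_down.
  - by exists y; split=> //; exact/up_subsetC_down.
split; first exact: Scott_kolmogorov.
move=> D /(eq_directed_for (@Scott_specialization d P)) dirD x U oU [u Uu].
(* Completeness supplies the supremum, so that the intersection over [D] becomes a single principal
   upper set. *)
have [s lubs] := hP _ dirD.
rewrite (bigcap_up_isLub _ _ lubs) -[U]setCK => /up_subsetC_down ns.
(* The point [u] of [U] makes the complement a proper closed set. *)
have /downcl/(_ x)/scott_closedE [_ downC] : (scott_closed P `\ setT) (~` U).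
  split; first by apply/scott_closedE; rewrite setCK.
  by move=> UT; have : (~` U) u by rewrite UT.
have [y [Dy ny]] := downC D s dirD lubs ns.
by exists y => //; exact/up_subsetC_down.
Qed.
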